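(* For every integer $n\geq 1$, $\mathrm{ex}_{\mathcal{P}}(n,S_{3,4})\leq \frac{20}{7}n$.
   Context: All graphs are finite and simple. For a graph $F$, the planar Turán number $\mathrm{ex}_{\mathcal{P}}(n,F)$ is the maximum number of edges in an $n$-vertex planar graph that contains no subgraph isomorphic to $F$. For positive integers $m,k$, the double star $S_{m,k}$ is the tree obtained from an edge $xy$ (the backbone) by joining $x$ to $m$ new vertices and $y$ to $k$ further new vertices, all these $m+k$ vertices distinct. *)

(* Defs.v *)
From Stdlib Require Import Reals.
From mathcomp Require Import all_boot.
Set Implicit Arguments. Unset Strict Implicit. Unset Printing Implicit Defensive.

Definition simple_graph (T : finType) (e : rel T) : Prop :=
  (forall x y, e x y = e y x) /\ (forall x, ~~ e x x).

Definition edge_set (T : finType) (e : rel T) : {set {set T}} :=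
  [set E : {set T} | [exists x, exists y, e x y && (E == [set x; y])]].

Definition num_edges (T : finType) (e : rel T) : nat := #|edge_set e|.

Definition contains_subgraph (U : finType) (f : rel U) (T : finType) (e : rel T) : Prop :=
  exists phi : U -> T, injective phi /\ forall u v, f u v -> e (phi u) (phi v).

(* Double star S_{m,k} on vertices 'I_(m+k+2):
   0 = x, 1 = y (backbone), 2..m+1 are leaves of x, m+2..m+k+1 leaves of y. *)
Definition double_star_adj (m k : nat) (i j : nat) : bool :=
  [|| (i == 0) && (j == 1),
      (i == 0) && (2 <= j < m + 2)
    | (i == 1) && (m + 2 <= j < m + k + 2)].

Definition double_star (m k : nat) : rel 'I_(m + k + 2) :=
  fun i j => double_star_adj m k i j || double_star_adj m k j i.

Arguments double_star : clear implicits.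

Local Open Scope R_scope.

Definition arc (g : R -> R * R) : Prop :=
  (forall t, 0 <= t <= 1 ->
     continuity_pt (fun s => fst (g s)) t /\ continuity_pt (fun s => snd (g s)) t) /\
  (forall s t, 0 <= s <= 1 -> 0 <= t <= 1 -> g s = g t -> s = t).

Definition planar (T : finType) (e : rel T) : Prop :=
  exists (p : T -> R * R) (c : T -> T -> R -> R * R),
    injective p /\
    forall x y, e x y ->
      [/\ arc (c x y), c x y 0 = p x, c x y 1 = p y,
          (forall t, 0 <= t <= 1 -> c y x t = c x y (1 - t)) &
          (forall z t, 0 < t < 1 -> c x y t <> p z)] /\
          (forall x' y', e x' y' -> forall s t, 0 < s < 1 -> 0 < t < 1 ->
              c x y s = c x' y' t ->
              (x' = x /\ y' = y) \/ (x' = y /\ y' = x)).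

(* Main.v *)
(* Sample every arc finely by a polygon and let n(i, kl) be the parity of the
   number of times the polygon of the edge kl crosses a fixed ray issuing from
   the vertex i. For two independent edges ij and kl the difference of the two
   arcs is a nowhere zero map on a square, so it has degree 0, and modulo 2 this
   reads n(i, kl) + n(j, kl) + n(k, ij) + n(l, ij) =
         s(i, k) + s(i, l) + s(j, k) + s(j, l)
   with s an antisymmetric relation on the vertices. Solvability of this system
   (the vanishing of the mod 2 van Kampen obstruction) is inherited by minors,
   and summing all its equations rules out K5 and K33. Mader's contraction
   argument then gives the bound 3n - 6 on the number of edges.

   In an S_{3,4}-free graph an edge xy with d(x) >= 4 and d(y) >= 5 satisfies
   d(x) + d(y) <= 8 + (number of common neighbours). So the closed neighbourhood
   of a vertex of degree 7 can be removed by induction, a vertex of degree >= 8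
   has only neighbours of degree <= 3, and the excess degree over 40/7 of the
   vertices of degree 6 or >= 8 can be discharged to their neighbours. Only the
   vertices of degree 3 all of whose neighbours have degree >= 8 are overcharged,
   and planarity bounds their number linearly in that of their neighbours. *)
Require Import Defs.
From Stdlib Require Import Reals Lra Classical ClassicalEpsilon Ring.
From Coquelicot Require Compactness.
From mathcomp Require Import all_boot zify.
Set Implicit Arguments. Unset Strict Implicit. Unset Printing Implicit Defensive.

(** * The mod 2 van Kampen obstruction *)

Section VanKampen.
Variable T : finType.
Implicit Types e : rel T.

(** Only the existence of a solution is recorded, not a drawing, so that the property can be carried
    along contractions. *)
Definition vk_trivial e :=
  exists (s : rel T) (n : T -> T -> T -> bool),
    (forall a b, a != b -> s b a = ~~ s a b) /\
    forall i j k l, e i j -> e k l -> [&& i != k, i != l, j != k & j != l] ->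
      xorb (xorb (xorb (n i k l) (n j k l)) (xorb (n k i j) (n l i j)))
           (xorb (xorb (s i k) (s i l)) (xorb (s j k) (s j l))) = false.

(** The vertex [v] is merged into [u] but stays in [T] as an isolated point, so the vertex type
    never changes. *)
Definition contract e (u v : T) : rel T := fun x y =>
  [&& x != v, y != v, x != y &
      [|| e x y, (x == u) && e v y | (y == u) && e x v]].

Lemma vk_trivial_sub e e' :
  (forall x y, e' x y -> e x y) -> vk_trivial e -> vk_trivial e'.
Proof.
move=> sub [s [n [sN rel_n]]]; exists s, n; split=> // i j k l eij ekl.
by apply: rel_n; apply: sub.
Qed.

Lemma contract_sym e u v : symmetric e -> symmetric (contract e u v).
Proof.
move=> esym x y; rewrite /contract (esym x y) (esym v y) (esym x v) (eq_sym y x).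
by rewrite andbCA; do 3!congr (_ && _); congr (_ || _); rewrite orbC.
Qed.

Lemma contract_irr e u v : irreflexive (contract e u v).
Proof. by move=> x; rewrite /contract eqxx /= !andbF. Qed.

(* An edge of the contraction that comes from [v] is drawn as a path of length
   two through [v], and the crossing equations of its two edges add up. *)
Lemma vk_trivial_contract e u v :
  symmetric e -> e u v -> vk_trivial e -> vk_trivial (contract e u v).
Proof.
move=> esym euv [s [n [sN rel_n]]].
pose m a x y := if e x y then n a x y
  else if x == u then xorb (n a u v) (n a v y) else xorb (n a x v) (n a v u).
have evu : e v u by rewrite esym.
have rel_m i j k l : e i j -> i != v -> j != v -> contract e u v k l ->
    [&& i != k, i != l, j != k & j != l] ->
    xorb (xorb (xorb (m i k l) (m j k l)) (xorb (n k i j) (n l i j)))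
         (xorb (xorb (s i k) (s i l)) (xorb (s j k) (s j l))) = false.
  move=> eij iv jv /and4P[kv lv kl H] dis; rewrite /m.
  case: ifPn => [ekl|nekl]; first exact: rel_n.
  rewrite (negbTE nekl) /= in H; case/and4P: dis => ik il jk jl.
  case: ifPn => [/eqP ku|ku].
    subst k; have {H} evl : e v l.
      by case/orP: H => /andP[] // /eqP lu; rewrite lu eqxx in kl.
    (* In the sum of the two equations [n v i j], [s i v] and [s j v] each occur twice and
       cancel. *)
    have E1 := rel_n i j u v eij euv; have E2 := rel_n i j v l eij evl.
    rewrite ik jk iv jv in E1; rewrite iv jv il jl in E2.
    rewrite -[RHS]/(xorb false false) -{1}(E1 isT) -(E2 isT); ring.
  rewrite (negbTE ku) /= in H; case/andP: H => /eqP lu ekv; subst l.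
  have E1 := rel_n i j k v eij ekv; have E2 := rel_n i j v u eij evu.
  rewrite ik jk iv jv in E1; rewrite iv jv il jl in E2.
  rewrite -[RHS]/(xorb false false) -{1}(E1 isT) -(E2 isT); ring.
exists s, m; split=> // i j k l Cij Ckl dis; case/and4P: (dis) => ik il jk jl.
have [[iv jv ij Hij] [kv lv kl Hkl]] := (and4P Cij, and4P Ckl).
have [eij|neij] := boolP (e i j).
  have := rel_m i j k l eij iv jv Ckl dis; by rewrite /m eij.
have dis' : [&& k != i, k != j, l != i & l != j].
  by rewrite !(eq_sym k) !(eq_sym l) ik il jk jl.
have ss a b : a != b -> s b a = xorb true (s a b) by move=> ?; rewrite sN //; case: (s a b).
have [ekl|nekl] := boolP (e k l).
  rewrite /(m i k l) /(m j k l) ekl -(rel_m k l i j ekl kv lv Cij dis').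
  rewrite (ss i k) // (ss i l) // (ss j k) // (ss j l) //; ring.
(* two new edges both end in u, so they are not independent *)
have inu x y : ~~ e x y -> [|| e x y, (x == u) && e v y | (y == u) && e x v] -> 
    (x == u) || (y == u).
  by move=> /negbTE->; case: (x == u); case: (y == u).
move: (inu _ _ neij Hij) (inu _ _ nekl Hkl).
by case/orP=> /eqP E; case/orP=> /eqP E'; subst; rewrite eqxx in ik il jk jl.
Qed.

(** All 15 equations are added. A vertex and an edge avoiding it occur together in two of them, so
    [n] cancels. Once every [s] term is oriented by the order a, b, c, d, f, only the interlaced
    pairing of each four vertices has an odd number of reversals; there are five such sets, so the
    sum is 1. *)
Lemma vk_trivial_noK5 e a b c d f :
  vk_trivial e -> uniq [:: a; b; c; d; f] ->
  [/\ e a b, e a c, e a d & e a f] -> [/\ e b c, e b d & e b f] ->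
  [/\ e c d, e c f & e d f] -> False.
Proof.
move=> [s [n [sN rel_n]]] /=; rewrite !inE !negb_or !andbT.
case/and4P=> /and4P[ab ac ad af] /and3P[bc bd bf] /andP[cd cf] df.
move=> [eab eac ead eaf] [ebc ebd ebf] [ecd ecf edf].
have ss x y : x != y -> s y x = xorb true (s x y) by move=> ?; rewrite sN //; case: (s x y).
pose q i j k l := xorb (xorb (xorb (n i k l) (n j k l)) (xorb (n k i j) (n l i j)))
           (xorb (xorb (s i k) (s i l)) (xorb (s j k) (s j l))).
have Q i j k l : e i j -> e k l -> i != k -> i != l -> j != k -> j != l -> q i j k l = false.
  by move=> eij ekl H1 H2 H3 H4; apply: rel_n => //; rewrite H1 H2 H3 H4.
have d' : [/\ b != a, c != a, d != a, f != a & c != b] /\ [/\ d != b, f != b, d != c, f != c & f != d].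
  by split; split; rewrite eq_sym.
case: d' => [[ba ca da fa cb] [db fb dc fc fd]].
suff: true = false by [].
transitivity (xorb (xorb (xorb (q a b c d) (xorb (q a b c f) (q a b d f)))
  (xorb (xorb (q a c b d) (xorb (q a c b f) (q a c d f)))
  (xorb (xorb (q a d b c) (xorb (q a d b f) (q a d c f)))
   (xorb (q a f b c) (xorb (q a f b d) (q a f c d))))))
   (xorb (q b c d f) (xorb (q b d c f) (q b f c d)))).
  rewrite /q (ss b c) // (ss b d) // (ss b f) // (ss c d) // (ss c f) // (ss d f) //; ring.
by rewrite !Q.
Qed.

(** The sum runs over the two pairs of opposite edges in each of the nine four-cycles. A cycle
    through [x] and [y] contributes [s x y] and [s y x] once each, hence 1; all other terms cancel
    in the total. *)
Lemma vk_trivial_noK33 e a b c x y z :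
  vk_trivial e -> uniq [:: a; b; c; x; y; z] ->
  [/\ e a x, e a y & e a z] -> [/\ e b x, e b y & e b z] ->
  [/\ e c x, e c y & e c z] -> False.
Proof.
move=> [s [n [sN rel_n]]] /=; rewrite !inE !negb_or !andbT.
case/and5P=> /and5P[ab ac ax ay az] /and4P[bc bx by_ bz] /and3P[cx cy cz] /andP[xy xz] yz.
move=> [eax eay eaz] [ebx eby ebz] [ecx ecy ecz].
have ss u v : u != v -> s v u = xorb true (s u v) by move=> ?; rewrite sN //; case: (s u v).
pose q i j k l := xorb (xorb (xorb (n i k l) (n j k l)) (xorb (n k i j) (n l i j)))
           (xorb (xorb (s i k) (s i l)) (xorb (s j k) (s j l))).
have Q i j k l : e i j -> e k l -> i != k -> i != l -> j != k -> j != l -> q i j k l = false.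
  by move=> eij ekl H1 H2 H3 H4; apply: rel_n => //; rewrite H1 H2 H3 H4.
have [xb xc yb yc] : [/\ x != b, x != c, y != b & y != c].
  by split; rewrite eq_sym.
have [zb zc yx zx zy] : [/\ z != b, z != c, y != x, z != x & z != y].
  by split; rewrite eq_sym.
suff: true = false by [].
pose r u v := xorb (xorb (xorb (q u x v y) (q u y v x)) (xorb (q u x v z) (q u z v x)))
   (xorb (q u y v z) (q u z v y)).
transitivity (xorb (r a b) (xorb (r a c) (r b c))).
  rewrite /r /q (ss x y) // (ss x z) // (ss y z) // (ss b x) // (ss b y) // (ss b z) // 
    (ss c x) // (ss c y) // (ss c z) //; ring.
by rewrite /r !Q.
Qed.

End VanKampen.

(** * Planar drawings *)

Section Crossings.
Local Open Scope R_scope.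
Implicit Types (u v : R * R) (f g : nat -> R * R).

Definition vsub u v : R * R := (fst u - fst v, snd u - snd v).
Local Notation "u '-v' v" := (vsub u v) (at level 50).

Definition posb (x : R) : bool := is_left (Rlt_dec 0 x).

Lemma posbP x : reflect (0 < x) (posb x).
Proof. by rewrite /posb; case: Rlt_dec => H; constructor. Qed.

(* Ties are broken so that [upper] always differs at [u] and at [- u]. *)
Definition upper u : bool :=
  posb (snd u) || ~~ posb (- snd u) && posb (fst u).

(* [cross u v] detects whether a short step from [u] to [v] crosses the negative
   half of the first axis. *)
Definition cross u v : bool :=
  [&& posb (- fst u), posb (- fst v) & upper u (+) upper v].

(** The four open coordinate half-planes: [k.2] selects the coordinate and [k.1] its sign. *)
Definition in_half (k : bool * bool) u : Prop :=
  0 < (if k.1 then 1 else -1) * (if k.2 then fst u else snd u).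

(** Only the left half-plane can see a crossing: the right one misses the ray, and [upper] is
    constant on the other two. *)
Lemma cross_half k u v : in_half k u -> in_half k v ->
  cross u v = (k == (false, true)) && (upper u (+) upper v).
Proof.
rewrite /in_half /cross /upper; case: k => [[] []] /= Hu Hv;
repeat (case: posbP => ? //=; try lra); by rewrite ?andbF.
Qed.

Definition vopp u : R * R := (- fst u, - snd u).

Lemma upper_vopp k u : in_half k u -> upper (vopp u) = ~~ upper u.
Proof.
rewrite /in_half /upper /= !Ropp_involutive; case: k => [[] []] /= Hu;
repeat (case: posbP => ? //=; try lra).
Qed.

Lemma in_half_vopp k u : in_half k u -> in_half (~~ k.1, k.2) (vopp u).
Proof. by rewrite /in_half; case: k => [[] []] /=; lra. Qed.

Lemma upper_half k u v : k.2 = false -> in_half k u -> in_half k v ->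
  upper u = upper v.
Proof.
rewrite /in_half /upper; case: k => [[] []] //= _ Hu Hv;
repeat (case: posbP => ? //=; try lra).
Qed.

(** A change of [upper] is a crossing of the whole first axis, on its negative half for the given
    points or on its negative half for their opposites. *)
Lemma cross_vopp k u v : in_half k u -> in_half k v ->
  cross (vopp u) (vopp v) = cross u v (+) (upper u (+) upper v).
Proof.
move=> Hu Hv; have [Nu Nv] := (in_half_vopp Hu, in_half_vopp Hv).
rewrite (cross_half Hu Hv) (cross_half Nu Nv) (upper_vopp Hu) (upper_vopp Hv).
case: k {Nu Nv} Hu Hv => [[] []] Hu Hv /=.
- by case: (upper u); case: (upper v).
- by rewrite (upper_half _ Hu Hv) // addbb.
- by case: (upper u); case: (upper v).
- by rewrite (upper_half _ Hu Hv) // addbb.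
Qed.

(* All four points lie in the same one of four coordinate half-planes, so that no
   path between them winds around the origin. *)
Definition tame u0 u1 v0 v1 : Prop :=
  exists k, [/\ in_half k u0, in_half k u1, in_half k v0 & in_half k v1].

(** In a common half-plane [cross] is zero or the coboundary of [upper], so it sums to zero around
    each quadrilateral of the strip. *)
Lemma cross_strip f g n : (forall t, (t < n)%N -> tame (f t) (f t.+1) (g t) (g t.+1)) ->
  cross (f 0%N) (g 0%N) (+) cross (f n) (g n) =
  (\big[addb/false]_(t < n) cross (f t) (f t.+1)) (+)
  (\big[addb/false]_(t < n) cross (g t) (g t.+1)).
Proof.
elim: n => [|n IH] H; first by rewrite !big_ord0 addbb.
rewrite !big_ord_recr /= addbACA -IH => [|t lt]; last by apply: H; rewrite ltnS ltnW.
have [k [h1 h2 h3 h4]] := H n (ltnSn n).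
rewrite (cross_half h1 h3) (cross_half h2 h4) (cross_half h1 h2) (cross_half h3 h4).
case: (k == _) => /=; last by rewrite !addbF.
by move: (upper (f n)) (upper (g n)) (upper (f n.+1)) (upper (g n.+1)) (cross _ _) => [] [] [] [] [].
Qed.

(* Parity of the crossings of the polygon [g] with the leftward ray from [u]. *)
Definition wind u g n : bool :=
  \big[addb/false]_(t < n) cross (g t -v u) (g t.+1 -v u).

(** Discrete form of degree 0: the crossings along the boundary of the grid of differences
    [f s - g t] sum to zero. *)
Lemma cross_grid f g n m :
  (forall s t, (s < n)%N -> (t < m)%N ->
     tame (f s -v g t) (f s -v g t.+1) (f s.+1 -v g t) (f s.+1 -v g t.+1)) ->
  wind (g 0%N) f n (+) wind (g m) f n =
  (\big[addb/false]_(t < m) cross (f 0%N -v g t) (f 0%N -v g t.+1)) (+)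
  (\big[addb/false]_(t < m) cross (f n -v g t) (f n -v g t.+1)).
Proof.
elim: n => [|n IH] H; first by rewrite /wind !big_ord0 !addbb.
rewrite /wind !big_ord_recr /= addbACA -!/(wind _ _ _).
rewrite IH => [|s t sn tm]; last by apply: H => //; apply: ltnW.
rewrite (@cross_strip (fun t => f n -v g t) (fun t => f n.+1 -v g t)) => [|t tm]; last exact: H.
by rewrite addbA -(addbA _ (\big[_/_]_(t < m) cross (f n -v _) _) (\big[_/_]_(t < m) cross (f n -v _) _)) addbb addbF.
Qed.

Lemma vsubN u v : u -v v = vopp (v -v u).
Proof. by rewrite /vopp /vsub /=; congr pair; lra. Qed.

Lemma upper_vsubC u v : u <> v -> upper (u -v v) = ~~ upper (v -v u).
Proof.
move=> ne; rewrite (vsubN u v).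
suff [k hk] : exists k, in_half k (v -v u) by exact: upper_vopp hk.
have sign (r r' : R) : r <> r' -> exists k : bool, 0 < (if k then 1 else -1) * (r - r').
  by move=> H; exists (posb (r - r')); case: posbP => ?; lra.
move: ne; case: u v => [x y] [x' y'] ne.
case: (Req_dec x' x) => [E|/sign[k Hk]]; last by exists (k, true).
by case: (@sign y' y) => [E'|k Hk]; [apply: ne; rewrite E E'|exists (k, false)].
Qed.

(** Turns the two grid sides on which [f] is fixed into winding parities; the corrections telescope
    to the ends of [g]. *)
Lemma wind_vopp u g m : (forall t, (t < m)%N -> exists k,
     in_half k (g t -v u) /\ in_half k (g t.+1 -v u)) ->
  \big[addb/false]_(t < m) cross (u -v g t) (u -v g t.+1) =
  wind u g m (+) (upper (g 0%N -v u) (+) upper (g m -v u)).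
Proof.
elim: m => [|m IH] H; first by rewrite /wind !big_ord0 addbb.
rewrite /wind !big_ord_recr /= -/(wind _ _ _) IH => [|t tm]; last by apply: H; apply: ltnW.
have [k [h1 h2]] := H m (ltnSn m).
rewrite (vsubN u (g m)) (vsubN u (g m.+1)) (cross_vopp h1 h2).
by move: (wind _ _ _) (upper _) (upper (g m -v u)) (cross _ _) (upper (g m.+1 -v u)) => [] [] [] [] [].
Qed.

Lemma wind_relation f g n m : (0 < n)%N -> (0 < m)%N ->
  (forall s t, (s < n)%N -> (t < m)%N ->
     tame (f s -v g t) (f s -v g t.+1) (f s.+1 -v g t) (f s.+1 -v g t.+1)) ->
  xorb (xorb (xorb (wind (f 0%N) g m) (wind (f n) g m))
             (xorb (wind (g 0%N) f n) (wind (g m) f n)))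
       (xorb (xorb (upper (g 0%N -v f 0%N)) (upper (g m -v f 0%N)))
             (xorb (upper (g 0%N -v f n)) (upper (g m -v f n)))) = false.
Proof.
move=> n0 m0 H; have := cross_grid H; rewrite !wind_vopp.
- move: (wind _ _ _) (wind _ _ _) (wind _ _ _) (wind _ _ _).
  by do 4!move: (upper _) => []; do 4!case.
- move=> t tm; have [|k [_ _ h1 h2]] := H n.-1 t _ tm; first by rewrite prednK.
  exists (~~ k.1, k.2); rewrite prednK // in h1 h2.
  by rewrite !(vsubN (g _)); split; apply: in_half_vopp.
- move=> t tm; have [k [h1 h2 _ _]] := H 0%N t n0 tm.
  by exists (~~ k.1, k.2); rewrite !(vsubN (g _)); split; apply: in_half_vopp.
Qed.

End Crossings.

(** * Sampling disjoint arcs finely enough *)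

Section Sampling.
Local Open Scope R_scope.
Local Notation "u '-v' v" := (vsub u v) (at level 50).

Definition cont01 (c : R -> R * R) := forall t, 0 <= t <= 1 ->
  continuity_pt (fun s => fst (c s)) t /\ continuity_pt (fun s => snd (c s)) t.

Lemma continuity_pt_ball (h : R -> R) t eps : continuity_pt h t -> 0 < eps ->
  exists d : R, 0 < d /\ forall s, Rabs (s - t) < d -> Rabs (h s - h t) < eps.
Proof.
move=> C eps0; have [d [d0 Hd]] := C _ eps0.
exists d; split=> // s Hs; case: (Req_dec s t) => [->|ne].
  by rewrite Rminus_diag Rabs_R0.
apply: Hd; split=> //; split=> //; exact: not_eq_sym.
Qed.

Lemma in_half_near (a b : R -> R * R) x y : cont01 a -> cont01 b ->
  0 <= x <= 1 -> 0 <= y <= 1 -> a x <> b y ->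
  exists d : R, 0 < d /\ exists k, forall x' y',
    Rabs (x' - x) < d -> Rabs (y' - y) < d -> in_half k (a x' -v b y').
Proof.
move=> Ca Cb x01 y01 ne.
have [a1 a2] := Ca x x01; have [b1 b2] := Cb y y01.
have near (al be : R -> R) : continuity_pt al x -> continuity_pt be y -> al x <> be y ->
    exists d : R, 0 < d /\ exists k : bool, forall x' y', Rabs (x' - x) < d -> Rabs (y' - y) < d ->
      0 < (if k then 1 else -1) * (al x' - be y').
  move=> c1 c2 nab; set r := Rabs (al x - be y) / 2.
  have r0 : 0 < r by rewrite /r; have := Rabs_pos_lt (al x - be y); lra.
  have [d1 [d10 H1]] := continuity_pt_ball c1 r0.
  have [d2 [d20 H2]] := continuity_pt_ball c2 r0.
  exists (Rmin d1 d2); split; first exact: Rmin_pos.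
  exists (posb (al x - be y)) => x' y' hx hy.
  have {}hx := Rlt_le_trans _ _ _ hx (Rmin_l _ _).
  have {}hy := Rlt_le_trans _ _ _ hy (Rmin_r _ _).
  have /Rabs_def2 [] := H1 _ hx; have /Rabs_def2 [] := H2 _ hy.
  by rewrite /r; case: posbP => ?; split_Rabs; lra.
case: (Req_dec (fst (a x)) (fst (b y))) => [e1|n1].
  have n2 : snd (a x) <> snd (b y).
    by move: ne e1; case: (a x) (b y) => [? ?] [? ?] /= ne e1 e2; apply: ne; rewrite e1 e2.
  have [d [d0 [k Hk]]] := near _ _ a2 b2 n2.
  by exists d; split=> //; exists (k, false).
have [d [d0 [k Hk]]] := near _ _ a1 b1 n1.
by exists d; split=> //; exists (k, true).
Qed.

Definition sample (c : R -> R * R) (n i : nat) := c (INR i / INR n).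

(** Near each point of the unit square the difference of the arcs stays in one half-plane;
    compactness makes the scale uniform. *)
Lemma sample_tame (a b : R -> R * R) : cont01 a -> cont01 b ->
  (forall x y, 0 <= x <= 1 -> 0 <= y <= 1 -> a x <> b y) ->
  exists n0 : nat, forall n, (n0 < n)%N -> forall s t, (s < n)%N -> (t < n)%N ->
    tame (sample a n s -v sample b n t) (sample a n s -v sample b n t.+1)
         (sample a n s.+1 -v sample b n t) (sample a n s.+1 -v sample b n t.+1).
Proof.
move=> Ca Cb dis.
(* The factor 2 leaves room for one further sampling step beyond the neighbourhood that contains the
   sample point. *)
have [del Hdel] : exists del : R -> R -> posreal, forall x y, 0 <= x <= 1 -> 0 <= y <= 1 ->
   exists k, forall x' y', Rabs (x' - x) < 2 * del x y -> Rabs (y' - y) < 2 * del x y ->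
     in_half k (a x' -v b y').
  have H x y : exists d : posreal, 0 <= x <= 1 -> 0 <= y <= 1 ->
     exists k, forall x' y', Rabs (x' - x) < 2 * d -> Rabs (y' - y) < 2 * d ->
     in_half k (a x' -v b y').
    case: (classic (0 <= x <= 1 /\ 0 <= y <= 1)) => [[x01 y01]|no].
      have [d [d0 [k Hk]]] := in_half_near Ca Cb x01 y01 (dis _ _ x01 y01).
      have h0 : 0 < d / 2 by lra.
      exists (mkposreal _ h0) => _ _; exists k => x' y' /= hx hy; apply: Hk; lra.
    by exists (mkposreal _ Rlt_0_1) => ? ?; case: no.
  exists (fun x y => proj1_sig (constructive_indefinite_description _ (H x y))) => x y.
  by case: constructive_indefinite_description.
have [d Hd] := Compactness.compactness_value_2d 0 1 0 1 del.
have [n0 Hn0] := INR_archimed d 1 (cond_pos d).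
exists n0 => n n0n s t sn tn.
have n_gt0 : 0 < INR n by apply: lt_0_INR; lia.
have nd : / INR n < d.
  apply: (Rmult_lt_reg_l (INR n)) => //; rewrite Rinv_r; last lra.
  have : INR n0 < INR n by apply: lt_INR; lia.
  have := cond_pos d; nra.
have in01 i : (i <= n)%N -> 0 <= INR i / INR n <= 1.
  move=> le; have : INR i <= INR n by apply: le_INR; lia.
  have := pos_INR i => h1 h2; split; first exact: Rle_mult_inv_pos.
  by apply: (Rmult_le_reg_r (INR n)) => //; rewrite /Rdiv Rmult_assoc Rinv_l; lra.
have step i : INR i.+1 / INR n = INR i / INR n + / INR n.
  by rewrite S_INR; field; lra.
have ninv0 := Rinv_0_lt_compat _ n_gt0.
have [x [y [x01 [y01 [hx [hy dle]]]]]] := NNPP _ (Hd _ _ (in01 s (ltnW sn)) (in01 t (ltnW tn))).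
have [k Hk] := Hdel _ _ x01 y01.
have [hs0 hs1] := Rabs_def2 _ _ hx; have [ht0 ht1] := Rabs_def2 _ _ hy.
by exists k; split; apply: Hk; rewrite ?step; apply: Rabs_def1; lra.
Qed.

Lemma unit_interval_cases z : 0 <= z <= 1 -> [\/ z = 0, z = 1 | 0 < z < 1].
Proof.
move=> [z0 z1]; case: (Req_dec z 0) => [->|?]; first by constructor 1.
case: (Req_dec z 1) => [->|?]; first by constructor 2.
constructor 3; lra.
Qed.

End Sampling.

Lemma planar_vk_trivial (T : finType) (e : rel T) : planar e -> vk_trivial e.
Proof.
move=> [p [c [p_inj C]]].
have [n0 Hn0] : exists n0 : nat, forall i j k l, e i j -> e k l ->
    [&& i != k, i != l, j != k & j != l] -> forall n, n0 < n -> forall s t, s < n -> t < n ->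
    tame (vsub (sample (c i j) n s) (sample (c k l) n t))
         (vsub (sample (c i j) n s) (sample (c k l) n t.+1))
         (vsub (sample (c i j) n s.+1) (sample (c k l) n t))
         (vsub (sample (c i j) n s.+1) (sample (c k l) n t.+1)).
  pose Q := fun (q : (T * T) * (T * T)) (n0 : nat) => e q.1.1 q.1.2 -> e q.2.1 q.2.2 ->
    [&& q.1.1 != q.2.1, q.1.1 != q.2.2, q.1.2 != q.2.1 & q.1.2 != q.2.2] ->
    forall n, n0 < n -> forall s t, s < n -> t < n ->
    tame (vsub (sample (c q.1.1 q.1.2) n s) (sample (c q.2.1 q.2.2) n t))
         (vsub (sample (c q.1.1 q.1.2) n s) (sample (c q.2.1 q.2.2) n t.+1))
         (vsub (sample (c q.1.1 q.1.2) n s.+1) (sample (c q.2.1 q.2.2) n t))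
         (vsub (sample (c q.1.1 q.1.2) n s.+1) (sample (c q.2.1 q.2.2) n t.+1)).
  have [N HN] : exists N, forall q, Q q (N q).
    apply: fin_all_exists => -[[i j] [k l]].
    case: (boolP [&& e i j, e k l, i != k, i != l, j != k & j != l]); last first.
      by move=> H; exists 0 => /= eij ekl dis; rewrite /= eij ekl dis in H.
    case/and3P=> eij ekl /and4P[ik il jk jl].
    have [[[Ca _] a0 a1 _ az] Cx] := C _ _ eij.
    have [[[Cb _] b0 b1 _ bz] _] := C _ _ ekl.
    have [//|//| |N HN] := @sample_tame (c i j) (c k l); last by exists N => _ _ _; exact: HN.
    move=> x y x01 y01 E.
    have pd i' j' : i' != j' -> p i' <> p j' by move=> /eqP H /p_inj.
    (* Two endpoints differ by injectivity of [p], an endpoint avoids the interior of an arc, and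
       two interiors meet only for the same edge. *)
    case: (unit_interval_cases x01) => hx; case: (unit_interval_cases y01) => hy; subst;
      move: E; rewrite ?a0 ?a1 ?b0 ?b1; try exact: pd.
    - by move=> /esym; apply: bz.
    - by move=> /esym; apply: bz.
    - exact: az.
    - exact: az.
    - move=> E; case: (Cx _ _ ekl _ _ hx hy E) => -[E1 E2]; subst.
        by rewrite eqxx in ik.
      by rewrite eqxx in il.
  exists (\max_q N q) => i j k l eij ekl dis n nn; apply: (HN ((i, j), (k, l))) => //.
  by apply: leq_ltn_trans nn; apply: (@leq_bigmax _ N).
pose n := n0.+1.
(* One sample size serves all edges, as it exceeds the largest threshold over the finitely many
   pairs. *)
exists (fun a b => upper (vsub (p b) (p a))), (fun i k l => wind (p i) (sample (c k l) n) n).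
split=> [a b ab|i j k l eij ekl dis].
  by apply: upper_vsubC => /p_inj E; rewrite E eqxx in ab.
have [[_ a0 a1 _ _] _] := C _ _ eij.
have [[_ b0 b1 _ _] _] := C _ _ ekl.
have n_neq0 : INR n <> R0 by rewrite /n S_INR; have := pos_INR n0; lra.
have s0 (h : R -> R * R) : sample h n 0 = h R0 by rewrite /sample /Rdiv Rmult_0_l.
have s1 (h : R -> R * R) : sample h n n = h R1 by rewrite /sample /Rdiv Rinv_r.
have := @wind_relation (sample (c i j) n) (sample (c k l) n) n n isT isT (Hn0 _ _ _ _ eij ekl dis n (ltnSn _)).
by rewrite !s0 !s1 a0 a1 b0 b1.
Qed.

(** * Edge counts *)

Section Counting.
Variable T : finType.
Implicit Types (e : rel T) (A B U V W : {set T}).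

Definition nb e U x : {set T} := [set y in U | e x y].
(* Every edge inside [U] is counted twice, once for each orientation. *)
Definition ecount e U := \sum_(x in U) #|nb e U x|.

Lemma in_nb e U x y : (y \in nb e U x) = (y \in U) && e x y.
Proof. by rewrite inE. Qed.

Lemma nb_sub e U x : nb e U x \subset U.
Proof. by apply/subsetP => y; rewrite in_nb => /andP[]. Qed.

Lemma sum_nb_sym e U V : symmetric e ->
  \sum_(x in U) #|nb e V x| = \sum_(y in V) #|nb e U y|.
Proof.
move=> esym; have E W x : #|nb e W x| = \sum_(y in W) e x y.
  by rewrite -sum1_card big_mkcond [RHS]big_mkcond; apply: eq_bigr => y _; rewrite in_nb; case: (y \in W); case: (e x y).
under eq_bigr do rewrite E; under [RHS]eq_bigr do rewrite E.
by rewrite exchange_big; apply: eq_bigr => y _; apply: eq_bigr => x _; rewrite esym.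
Qed.

Lemma card_nb_split e U V x : V \subset U ->
  #|nb e U x| = #|nb e V x| + #|nb e (U :\: V) x|.
Proof.
move=> /setIidPr sVU; rewrite -(cardsID V (nb e U x)).
have -> : nb e U x :&: V = nb e V x.
  by apply/setP => y; rewrite !inE -{2}sVU inE andbAC.
by have -> : nb e U x :\: V = nb e (U :\: V) x by apply/setP => y; rewrite !inE andbA.
Qed.

Lemma ecount_split e U V : symmetric e -> V \subset U ->
  ecount e U = ecount e V + ecount e (U :\: V) + 2 * \sum_(x in V) #|nb e (U :\: V) x|.
Proof.
move=> esym sVU; rewrite /ecount (big_setID V) /= (setIidPr sVU).
under eq_bigr do rewrite (card_nb_split _ _ sVU).
under [X in _ + X]eq_bigr do rewrite (card_nb_split _ _ sVU).
by rewrite !big_split /= (sum_nb_sym (U :\: V) V esym); lia.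
Qed.

Lemma card_nb_lt e U x : irreflexive e -> x \in U -> #|nb e U x| < #|U|.
Proof.
move=> eirr xU; apply: proper_card; apply/properP; split; first exact: nb_sub.
by exists x => //; rewrite in_nb eirr andbF.
Qed.

Lemma ecount_complete e U : irreflexive e -> ecount e U <= #|U| * #|U|.-1.
Proof.
move=> eirr; rewrite -sum_nat_const; apply: leq_sum => x xU.
by have := card_nb_lt eirr xU; lia.
Qed.

Lemma ecount_delete e U x : symmetric e -> irreflexive e -> x \in U ->
  ecount e U = ecount e (U :\ x) + 2 * #|nb e U x|.
Proof.
move=> esym eirr xU; have sx : [set x] \subset U by rewrite sub1set.
rewrite (ecount_split esym sx) big_set1 (card_nb_split e x sx) /ecount big_set1.
suff -> : #|nb e [set x] x| = 0 by lia.
by apply/eqP; rewrite cards_eq0; apply/eqP/setP=> y; rewrite !inE; case: eqP => // ->; rewrite eirr.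
Qed.

Lemma ecount_le e e' U : {in U &, forall x y, e x y -> e' x y} ->
  ecount e U <= ecount e' U.
Proof.
move=> H; apply: leq_sum => x xU; apply: subset_leq_card; apply/subsetP => y.
by rewrite !in_nb => /andP[yU exy]; rewrite yU H.
Qed.

Lemma ecount_min_degree e U k : ecount e U < k.+1 * #|U| ->
  exists2 x, x \in U & #|nb e U x| <= k.
Proof.
move=> H; apply/exists_inP; apply: contraLR H => /exists_inPn H.
rewrite -leqNgt mulnC -sum_nat_const; apply: leq_sum => x /H; lia.
Qed.

(** The loss is the edge [uv] and one of two parallel edges per common neighbour, each counted
    twice. *)
Lemma ecount_contract e U u v : symmetric e -> irreflexive e ->
  u \in U -> v \in U -> e u v ->
  ecount e U <= ecount (contract e u v) (U :\ v) + 2 + 2 * #|nb e U u :&: nb e U v|.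
Proof.
move=> esym eirr uU vU euv.
have uv : u != v by apply: contraTneq euv => ->; rewrite eirr.
have uU' : u \in U :\ v by rewrite !inE uv.
rewrite (ecount_delete esym eirr vU) (ecount_delete esym eirr uU').
rewrite (ecount_delete (contract_sym _ _ esym) (@contract_irr _ _ _ _) uU').
have le1 : ecount e (U :\ v :\ u) <= ecount (contract e u v) (U :\ v :\ u).
  apply: ecount_le => x y; rewrite !inE => /and3P[xu xv _] /and3P[yu yv _] exy.
  rewrite /contract xv yv exy /= andbT.
  by apply: contraTneq exy => ->; rewrite eirr.
have cu : #|nb e U u| = #|nb e (U :\ v) u| + 1.
  rewrite (cardsD1 v) in_nb vU euv addnC.
  by have -> : nb e U u :\ v = nb e (U :\ v) u by apply/setP => y; rewrite !inE andbA.
have sub : (nb e U u :|: nb e U v) :\ v :\ u \subset nb (contract e u v) (U :\ v) u.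
  apply/subsetP => y; rewrite !inE => /and3P[yu yv]; rewrite /contract uv yv eqxx (eq_sym u) yu /=.
  by case/orP => /andP[-> ->]; rewrite ?orbT.
have := subset_leq_card sub; have := cardsU (nb e U u) (nb e U v).
have := cardsD1 v (nb e U u :|: nb e U v).
have := cardsD1 u ((nb e U u :|: nb e U v) :\ v).
rewrite !inE uv vU uU euv (esym v u) euv /= orbT.
have := subset_leq_card (subsetIl (nb e U u) (nb e U v)).
lia.
Qed.

Definition del_edge e u v : rel T := fun x y =>
  e x y && ~~ ((x == u) && (y == v) || (x == v) && (y == u)).

Lemma ecount_del_edge e U u v : symmetric e -> irreflexive e ->
  u \in U -> v \in U -> e u v -> ecount e U = ecount (del_edge e u v) U + 2.
Proof.
move=> esym eirr uU vU euv.
have uv : u != v by apply: contraTneq euv => ->; rewrite eirr.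
have dsym : symmetric (del_edge e u v).
  by move=> x y; rewrite /del_edge esym orbC (andbC (y == v)) (andbC (y == u)).
have dirr : irreflexive (del_edge e u v) by move=> x; rewrite /del_edge eirr.
rewrite (ecount_delete esym eirr uU) (ecount_delete dsym dirr uU).
have -> : ecount e (U :\ u) = ecount (del_edge e u v) (U :\ u).
  apply/eqP; rewrite eqn_leq; apply/andP; split; apply: ecount_le => x y.
    by rewrite !inE /del_edge => /andP[/negbTE-> _] /andP[/negbTE-> _] ->; rewrite andbF.
  by move=> _ _ /andP[].
rewrite (cardsD1 v (nb e U u)) in_nb vU euv.
have -> : nb e U u :\ v = nb (del_edge e u v) U u; last lia.
apply/setP => y; rewrite !inE /del_edge eqxx (negbTE uv) /= orbF.
by rewrite andbC andbA.
Qed.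

(** * Mader's bound on the number of edges *)

Lemma no_clique5 e U : vk_trivial e -> 5 <= #|U| ->
  {in U &, forall x y, x != y -> e x y} -> False.
Proof.
move=> vke; rewrite cardE => U5 cl.
have {}cl : {in enum U &, forall x y, x != y -> e x y}.
  by move=> x y; rewrite !mem_enum; apply: cl.
case: (enum U) (enum_uniq U) U5 cl => [|a [|b [|c [|d [|f r]]]]] // un _ cl.
have un5 : uniq [:: a; b; c; d; f].
  by have := take_uniq 5 un; rewrite /= take0.
have {}cl : {in [:: a; b; c; d; f] &, forall x y, x != y -> e x y}.
  move=> x y xs ys; apply: cl; [move: xs|move: ys]; rewrite !inE; do 4!(case/orP => [->|]; rewrite ?orbT //); by move=> ->; rewrite ?orbT.
move: (un5) => /=; rewrite !inE !negb_or !andbT.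
case/and4P=> /and4P[ab ac ad af] /and3P[bc bd bf] /andP[cd cf] df.
by apply: (vk_trivial_noK5 vke un5); split; apply: cl => //; rewrite !inE eqxx ?orbT.
Qed.

(* If the link [W] of [x] has five vertices, its non-edges form a matching; when
   this matching is not empty, contracting an edge of [W] that meets all the
   non-edges leaves a complete graph on five vertices. *)
Lemma dense_link e W x : symmetric e -> irreflexive e -> vk_trivial e ->
  4 <= #|W| <= 5 -> {in W, forall y, e x y} -> {in W, forall y, 3 <= #|nb e W y|} ->
  False.
Proof.
move=> esym eirr vke W45 xW W3.
have xNW : x \notin W by apply/negP => /xW; rewrite eirr.
have ne y z : e y z -> y != z by move=> eyz; apply: contraTneq eyz => ->; rewrite eirr.
have [cl|] := boolP [forall y in W, forall z in W, (y != z) ==> e y z].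
  apply: (@no_clique5 e (x |: W)) => //; first by rewrite cardsU1 xNW; lia.
  move=> y z; rewrite !inE => /predU1P[->|yW] /predU1P[->|zW]; rewrite ?eqxx //.
  - by rewrite xW.
  - by rewrite esym xW.
  by move=> yz; move/forall_inP: cl => /(_ y yW) /forall_inP /(_ z zW); rewrite yz.
(* A vertex of [W] has at most one non-neighbour besides itself, because [W] has at most five
   elements and degrees are at least 3. *)
have one y z w : y \in W -> z \in W -> w \in W -> z != y -> w != y -> z != w ->
    ~~ e y z -> e y w.
  move=> yW zW wW zy wy zw nyz; apply/negPn/negP => nyw.
  have s : y |: [set z; w] \subset W :\: nb e W y.
    apply/subsetP => t; rewrite !inE => /or3P[]/eqP->; rewrite ?yW ?zW ?wW ?eirr ?andbT //=.
  have := subset_leq_card s; rewrite cardsU1 cards2 !inE zw (eq_sym y z) (eq_sym y w) (negbTE zy) (negbTE wy).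
  have := cardsID (nb e W y) W; rewrite (setIidPr (nb_sub _ _ _)).
  have := W3 y yW; move: W45; clear; lia.
case/forall_inPn => a aW /forall_inPn[b bW]; rewrite negb_imply => /andP[ab nab].
have W4' : #|W| = 5.
  have := W3 a aW; have s : [set a; b] \subset W :\: nb e W a.
    by apply/subsetP => t; rewrite !inE => /orP[]/eqP->; rewrite ?aW ?bW ?eirr ?andbT.
  have := subset_leq_card s; rewrite cards2 ab.
  have := cardsID (nb e W a) W; rewrite (setIidPr (nb_sub _ _ _)); lia.
have ba : b != a by rewrite eq_sym.
have nba : ~~ e b a by rewrite esym.
pose W' := W :\ a :\ b.
have W'3 : #|W'| = 3.
  have := cardsD1 a W; have := cardsD1 b (W :\ a).
  by rewrite !inE aW bW ba /= -/W' W4'; lia.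
(* The three vertices of [W'] span at most one non-edge; [c] is an end of it, or arbitrary if there
   is none. The edge [ac] is then the one to contract. *)
have [c cW' Hc] : exists2 c, c \in W' & {in W' :\ c &, forall p q, p != q -> e p q}.
  have [cl|] := boolP [forall y in W', forall z in W', (y != z) ==> e y z].
    have /card_gt0P[c cW'] : 0 < #|W'| by rewrite W'3.
    exists c => // p q /setD1P[_ pW] /setD1P[_ qW] pq.
    by move/forall_inP: cl => /(_ p pW) /forall_inP /(_ q qW); rewrite pq.
  case/forall_inPn => c cW' /forall_inPn[d dW']; rewrite negb_imply => /andP[cd ncd].
  exists c => // p q /setD1P[pc pW'] /setD1P[qc qW'] pq.
  have [dW cW pW qW] : [/\ d \in W, c \in W, p \in W & q \in W].
    by move: dW' cW' pW' qW'; rewrite !inE => /and3P[_ _ ->] /and3P[_ _ ->] /and3P[_ _ ->] /and3P[_ _ ->].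
  have [Ed|pd] := eqVneq p d.
    by subst p; apply: (@one d c q) => //; rewrite 1?esym 1?eq_sym // eq_sym.
  have [Ed|qd] := eqVneq q d.
    by subst q; rewrite esym; apply: (@one d c p) => //; rewrite 1?esym 1?eq_sym // eq_sym.
  have s : c |: (d |: [set p; q]) \subset W'.
    by apply/subsetP => t /setU1P[->//|/setU1P[->//|/set2P[]->//]].
  have := subset_leq_card s; rewrite W'3 2!cardsU1 cards2 !inE pq (negbTE cd).
  by rewrite !(eq_sym c) !(eq_sym d) (negbTE pc) (negbTE qc) (negbTE pd) (negbTE qd).
move: (cW'); rewrite !inE => /and3P[cb ca cW].
have eac : e a c by apply: (@one a b c) => //; rewrite eq_sym.
apply: (@no_clique5 (contract e a c) (x |: (a |: (W :\ a :\ c)))).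
- exact: vk_trivial_contract.
- rewrite !cardsU1 !inE eqxx (negbTE xNW) !andbF orbF.
  have := cardsD1 a W; have := cardsD1 c (W :\ a); rewrite !inE ca cW aW /= W4'.
  have -> : x != a by apply: contraNneq xNW => ->.
  by rewrite /=; clear; lia.
have xc : x != c by apply: contraNneq xNW => ->.
have ac : a != c by rewrite eq_sym.
move=> p q P Q pq.
suff H : forall p q, p \in x |: (a |: W :\ a :\ c) -> q \in x |: (a |: W :\ a :\ c) -> p != q -> p != c -> q != c ->
   p = x \/ (p = a /\ q != x) \/ (p \in W :\ a :\ c /\ q \in W :\ a :\ c) -> contract e a c p q.
  have memc t : t \in x |: (a |: W :\ a :\ c) -> t != c.
    by rewrite !inE => /or3P[/eqP->|/eqP->|/and3P[]].
  have csym := contract_sym a c esym.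
  have [pc qc] := (memc _ P, memc _ Q).
  move: (P) (Q); rewrite !(in_setU1 _ x) !(in_setU1 _ a) => /or3P[/eqP Ep|/eqP Ep|pW] /or3P[/eqP Eq|/eqP Eq|qW];
   subst; rewrite ?eqxx // in pq.
  - by apply: H => //; left.
  - by apply: H => //; left.
  - by rewrite csym; apply: H => //; [rewrite eq_sym|left].
  - apply: H => //; right; left; split=> //; rewrite eq_sym; apply: contraNneq xNW => ->.
    by move: qW; rewrite !inE => /and3P[].
  - by rewrite csym; apply: H => //; [rewrite eq_sym|left].
  - rewrite csym; apply: H => //; first by rewrite eq_sym.
    right; left; split=> //; apply: contraNneq xNW => <-.
    by move: pW; rewrite !inE => /and3P[].
  - by apply: H => //; right; right.
move=> {P Q pq} {}p {}q P Q pq pc qc; rewrite /contract pc qc pq /=; case=> [Ep|[[Ep qx]|[pW qW]]].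
- subst p; move: Q; rewrite !inE eq_sym (negbTE pq) /= => /predU1P[->|/and3P[_ _ qW]].
    by rewrite xW.
  by rewrite xW.
- subst p; move: Q; rewrite !inE (negbTE qx) eq_sym (negbTE pq) eqxx /= => /andP[_ qW].
  have qa : q != a by rewrite eq_sym.
  have [//|naq] := boolP (e a q).
  suff -> : e c q by rewrite ?orbT.
  by rewrite esym; apply: (@one q a c) => //; rewrite 1?eq_sym // esym.
- move: pW qW; rewrite !inE => /and3P[_ pa pW] /and3P[_ qa qW].
  suff -> : e p q by [].
  have [Ep|pb] := eqVneq p b; first by subst p; apply: (@one b a q) => //; rewrite eq_sym.
  have [Eq|qb] := eqVneq q b; first by subst q; rewrite esym; apply: (@one b a p) => //; rewrite eq_sym.
  by apply: Hc => //; rewrite !inE ?pc ?qc ?pa ?pb ?qa ?qb.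
Qed.

(** Deleting a vertex of degree at most 3, or contracting an edge with at most two common
    neighbours, loses at most 6. Otherwise degrees are at least 4 and every edge lies in three
    triangles, so a vertex of degree at most 5 would have a dense link. *)
Lemma ecount_bound e U : symmetric e -> irreflexive e -> vk_trivial e ->
  3 <= #|U| -> ecount e U + 12 <= 6 * #|U|.
Proof.
have [m] := ubnP (#|U| + ecount e U); elim: m e U => // m IH e U lt_m esym eirr vke U3.
have [U4|U5] := leqP #|U| 4.
  have := ecount_complete U eirr; have : #|U| = 3 \/ #|U| = 4 by lia.
  by case=> ->; lia.
have cardD1 x : x \in U -> #|U| = (#|U :\ x|).+1 by move=> xU; rewrite (cardsD1 x U) xU.
have [/exists_inP[x xU dx]|/exists_inPn deg4] := boolP [exists x in U, #|nb e U x| <= 3].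
  have := cardD1 x xU; have := ecount_delete esym eirr xU => E1 E2.
  have : ecount e (U :\ x) + 12 <= 6 * #|U :\ x| by apply: IH => //; lia.
  lia.
have [/exists_inP[u uU /exists_inP[v vU /andP[euv cn]]]|/exists_inPn cn3] :=
  boolP [exists u in U, exists v in U, e u v && (#|nb e U u :&: nb e U v| <= 2)].
  have := cardD1 v vU; have := ecount_contract esym eirr uU vU euv => E1 E2.
  (* The induction measure also contains the edge count, which must not grow. *)
  have E3 : ecount (contract e u v) (U :\ v) <= ecount e U.
    have := ecount_delete esym eirr vU; have := deg4 v vU; rewrite -ltnNge.
    have uU' : u \in U :\ v by rewrite !inE uU andbT; apply: contraTneq euv => ->; rewrite eirr.
    rewrite (ecount_delete esym eirr uU').
    rewrite (ecount_delete (contract_sym u v esym) (@contract_irr _ e u v) uU').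
    have : ecount (contract e u v) (U :\ v :\ u) <= ecount e (U :\ v :\ u).
      apply: ecount_le => x y; rewrite !inE => /andP[xu _] /andP[yu _].
      by rewrite /contract (negbTE xu) (negbTE yu) /= orbF => /and4P[].
    have : #|nb (contract e u v) (U :\ v) u| <= #|nb e (U :\ v) u| + #|nb e U v|.
      rewrite -cardsUI; apply: leq_trans (leq_addr _ _).
      apply: subset_leq_card; apply/subsetP => y; rewrite !inE /contract eqxx /=.
      case/andP => /andP[yv yU] /and4P[_ _ uy]; rewrite yv yU (eq_sym y) (negbTE uy) /= orbF.
      by [].
    lia.
  have : ecount (contract e u v) (U :\ v) + 12 <= 6 * #|U :\ v|.
    apply: IH; rewrite ?E2; try lia; [exact: contract_sym|exact: contract_irr|exact: vk_trivial_contract].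
  lia.
rewrite leqNgt; apply/negP => big.
have /card_gt0P[u uU] : 0 < #|U| by lia.
have /card_gt0P[v] : 0 < #|nb e U u| by have := deg4 u uU; rewrite -ltnNge; lia.
rewrite in_nb => /andP[vU euv].
have E1 := ecount_del_edge esym eirr uU vU euv.
(* By induction one edge less already meets the bound, so the excess is at most one edge and some
   degree is at most 5. *)
have E2 : ecount (del_edge e u v) U + 12 <= 6 * #|U|.
  apply: IH => //; first by lia.
  - by move=> x y; rewrite /del_edge esym orbC (andbC (y == v)) (andbC (y == u)).
  - by move=> x; rewrite /del_edge eirr.
  by apply: vk_trivial_sub vke => x y /andP[].
have [x xU dx] : exists2 x, x \in U & #|nb e U x| <= 5 by apply: ecount_min_degree; lia.
apply: (@dense_link e (nb e U x) x) => //.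
- by have := deg4 x xU; rewrite -ltnNge => ->.
- by move=> y; rewrite in_nb => /andP[].
move=> y; rewrite in_nb => /andP[yU exy].
have /exists_inPn/(_ y yU) := cn3 x xU; rewrite exy /= -ltnNge => lt2.
apply: leq_trans lt2 _; apply: subset_leq_card; apply/subsetP => z.
by rewrite !inE => /andP[/andP[-> ->] /andP[_ ->]].
Qed.

(* Either some [b] has two non-adjacent neighbours in [A] and can be contracted
   into one of them, or the links of all [b] are cliques; then a vertex of [A] of
   degree [d <= 5] in [A] is in at most [2d - 3] triangles, each seen by at most
   two elements of [B]. *)
Lemma three_nbs_bound e A B : symmetric e -> irreflexive e -> vk_trivial e ->
  [disjoint A & B] -> {in B, forall b, 3 <= #|nb e A b|} ->
  2 * #|B| + ecount e A <= 38 * #|A|.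
Proof.
have [m] := ubnP (#|A| + #|B|); elim: m e A B => // m IH e A B lt_m esym eirr vke AB B3.
have AnB x b : x \in A -> b \in B -> x != b.
  by move=> xA bB; apply: contraTneq bB => <-; rewrite (disjointFr AB).
have [/exists_inP[b bB /exists_inP[x xA /exists_inP[y yA /and4P[ebx eby xy nxy]]]]|/exists_inPn clq] :=
  boolP [exists b in B, exists x in A, exists y in A, [&& e b x, e b y, x != y & ~~ e x y]].
  have exb : e x b by rewrite esym.
  have csym := contract_sym x b esym; have cirr := @contract_irr _ e x b.
  have sub p q : p != b -> q != b -> e p q -> contract e x b p q.
    move=> pb qb epq; rewrite /contract pb qb epq /= andbT.
    by apply: contraTneq epq => ->; rewrite eirr.
  (* The new edge [xy] adds 2, which pays for the loss of [b] from [B]. *)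
  have E1 : ecount e A + 2 <= ecount (contract e x b) A.
    rewrite (ecount_delete esym eirr xA) (ecount_delete csym cirr xA).
    have : ecount e (A :\ x) <= ecount (contract e x b) (A :\ x).
      by apply: ecount_le => p q; rewrite !inE => /andP[_ pA] /andP[_ qA]; apply: sub; apply: AnB.
    suff : #|nb e A x| + 1 <= #|nb (contract e x b) A x| by lia.
    have <- : #|y |: nb e A x| = #|nb e A x| + 1 by rewrite cardsU1 in_nb yA nxy addnC.
    apply: subset_leq_card; apply/subsetP => z; rewrite !inE => /predU1P[->|/andP[zA exz]].
      by rewrite yA /contract xy !AnB // eby eqxx /= orbT.
    by rewrite zA sub ?AnB.
  have := cardsD1 b B; rewrite bB => cB.
  have : 2 * #|B :\ b| + ecount (contract e x b) A <= 38 * #|A|.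
    apply: IH => //; [by lia|exact: vk_trivial_contract| |].
      by apply: disjointWr AB; apply: subsetDl.
    move=> b'; rewrite !inE => /andP[b'b b'B]; apply: leq_trans (B3 _ b'B) _.
    apply: subset_leq_card; apply/subsetP => z; rewrite !inE => /andP[zA eb'z].
    by rewrite zA sub // AnB.
  lia.
have [A0|[x0 x0A]] := set_0Vmem A.
  have -> : B = set0.
    apply/eqP; apply/set0Pn => -[b /B3].
    have := subset_leq_card (nb_sub e A b); rewrite A0 cards0; lia.
  by rewrite A0 /ecount big_set0 cards0.
have [x xA dx] : exists2 x, x \in A & #|nb e A x| <= 5.
  have [A3|A3] := ltnP #|A| 3; last first.
    apply: ecount_min_degree; have := ecount_bound esym eirr vke A3; lia.
  by exists x0 => //; have := card_nb_lt eirr x0A; lia.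
pose D := nb e A x; pose Bx := nb e B x.
have Dx : x \notin D by rewrite in_nb eirr andbF.
have link b : b \in Bx -> 2 <= #|nb e D b|.
  rewrite in_nb => /andP[bB exb]; have := B3 b bB; rewrite (cardsD1 x) in_nb xA esym exb /= => H.
  suff : #|nb e A b :\ x| <= #|nb e D b| by lia.
  apply: subset_leq_card; apply/subsetP => y; rewrite !inE => /and3P[yx yA eby].
  rewrite yA eby andbT /=; apply/negPn/negP => nxy.
  have /exists_inPn/(_ x xA)/exists_inPn/(_ y yA) := clq b bB.
  by rewrite esym exb eby eq_sym yx nxy.
(* Double count of the ordered edges [yz] in the link of [x] with both ends adjacent to [b]: each
   [b] has at least two, and three different [b] on one [yz] would form a K33 with [x], [y], [z]. *)
have count : 2 * #|Bx| <= \sum_(y in D) \sum_(z in nb e D y) 2.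
  have H : 2 * #|Bx| <= \sum_(b in Bx) \sum_(y in nb e D b) \sum_(z in nb e D y | e b z) 1.
    rewrite mulnC -sum_nat_const; apply: leq_sum => b bBx.
    apply: leq_trans (link b bBx) _; rewrite -sum1_card; apply: leq_sum => y yD.
    have := link b bBx; rewrite (cardsD1 y) yD => lk.
    have /card_gt0P[z] : 0 < #|nb e D b :\ y| by lia.
    rewrite !inE => /and3P[zy /andP[zA exz] ebz].
    move: yD bBx; rewrite !inE => /andP[/andP[yA exy] eby] /andP[bB exb].
    rewrite (bigD1 z) //= !inE zA exz ebz /= andbT.
    have /exists_inPn/(_ y yA)/exists_inPn/(_ z zA) := clq b bB.
    by rewrite eby ebz eq_sym zy /= negbK.
  apply: leq_trans H _.
  under eq_bigr => b _ do under eq_bigr => y _ do rewrite big_mkcondr /=.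
  under eq_bigr => b _ do (under eq_bigl => y do rewrite in_nb; rewrite big_mkcondr /=).
  rewrite exchange_big /=; apply: leq_sum => y yD.
  under eq_bigr => b _ do rewrite (fun_if (fun n => n)).
  apply: (@leq_trans (\sum_(b in Bx) \sum_(z in nb e D y) (e b y && e b z))).
    apply: leq_sum => b _; case: (e b y) => //; apply: leq_sum => z _; by case: (e b z).
  rewrite exchange_big /=; apply: leq_sum => z zDy.
  rewrite leqNgt; apply/negP.
  have -> : \sum_(b in Bx) (e b y && e b z) = #|[set b in Bx | e b y && e b z]|.
    rewrite -sum1_card big_mkcond [RHS]big_mkcond; apply: eq_bigr => b _.
    by rewrite [in RHS]in_set; case: (b \in Bx); case: (e b y); case: (e b z).
  case/card_gt2P => b1 [b2 [b3 [[]]]]; rewrite !inE.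
  move=> /and3P[/andP[b1B exb1] e1y e1z] /and3P[/andP[b2B exb2] e2y e2z] /and3P[/andP[b3B exb3] e3y e3z] [b12 b23 b31].
  move: zDy yD; rewrite !inE => /andP[/andP[zA exz] eyz] /andP[yA exy].
  have ne p q : e p q -> p != q by move=> epq; apply: contraTneq epq => ->; rewrite eirr.
  apply: (@vk_trivial_noK33 _ e b1 b2 b3 x y z vke).
    rewrite /= !inE !negb_or b12 b23 (eq_sym b1 b3) b31.
    by rewrite !ne // esym.
  - by split=> //; rewrite esym.
  - by split=> //; rewrite esym.
  - by split=> //; rewrite esym.
have {}count : #|Bx| <= ecount e D.
  by move: count; under eq_bigr do rewrite sum_nat_const; rewrite -big_distrl /= -/(ecount e D); lia.
(* The planar bound for [x] with its link gives [ecount e D <= 4 * #|D| - 6 <= 14], and [#|D| <= 5].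
   Removing [x] and [Bx] thus costs at most [2 * 19 = 38]. *)
have small : #|Bx| + #|D| <= 19.
  have [->|[b bBx]] := set_0Vmem Bx; first by rewrite cards0 /D; lia.
  have D2 : 2 <= #|D| by apply: leq_trans (link b bBx) (subset_leq_card (nb_sub _ _ _)).
  have cD : #|x |: D| = #|D|.+1 by rewrite cardsU1 Dx.
  have := @ecount_bound e (x |: D) esym eirr vke; rewrite cD => /(_ D2).
  rewrite (ecount_delete esym eirr (setU11 x D)).
  have -> : (x |: D) :\ x = D by rewrite setU1K.
  have -> : nb e (x |: D) x = D.
    by apply/setP => y; rewrite !inE; case: eqP => [->|]; rewrite /= ?eirr ?andbF // => _; case: (e x y); rewrite ?andbF ?andbT.
  by have : #|D| <= 5 := dx; move: count; clear; lia.
have := cardsD1 x A; rewrite xA => cA.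
have cB : #|B| = #|Bx| + #|B :\: Bx| by rewrite -(cardsID Bx B) (setIidPr (nb_sub _ _ _)).
have : 2 * #|B :\: Bx| + ecount e (A :\ x) <= 38 * #|A :\ x|.
  apply: IH => //; first by lia.
    apply: disjointWl (subsetDl _ _) _; apply: disjointWr (subsetDl _ _) _; exact: AB.
  move=> b; rewrite !inE => /andP[]; case bB: (b \in B) => //= nxb _.
  apply: leq_trans (B3 b bB) _; apply: subset_leq_card; apply/subsetP => y; rewrite !inE => /andP[yA eby].
  by rewrite yA eby !andbT; apply: contraNneq nxb => <-; rewrite esym.
rewrite (ecount_delete esym eirr xA) -/D; lia.
Qed.

End Counting.

(** * Discharging *)

Section DoubleStar.
Variable T : finType.
Implicit Types (e : rel T) (U X Y : {set T}).

Lemma subset_of_card X k : k <= #|X| -> exists2 Y : {set T}, Y \subset X & #|Y| = k.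
Proof.
move=> kX; exists [set x in take k (enum X)].
  by apply/subsetP => x; rewrite inE => /mem_take; rewrite mem_enum.
by rewrite cardsE (card_uniqP (take_uniq _ (enum_uniq _))) size_takel // -cardE.
Qed.

(** [X'] is filled from outside [Y] first, so it takes elements of [Y] only when [X :\: Y] is
    exhausted; the size of the union then leaves [k] of them. *)
Lemma split_double_star X Y m k : m <= #|X| -> k <= #|Y| -> m + k <= #|X :|: Y| ->
  exists X' Y' : {set T}, [/\ X' \subset X, Y' \subset Y, [disjoint X' & Y'], #|X'| = m & #|Y'| = k].
Proof.
move=> Xm Yk XYmk.
suff [X' [sX' cX' YX']] : exists X' : {set T}, [/\ X' \subset X, #|X'| = m & k <= #|Y :\: X'|].
  have [Y' sY' cY'] := subset_of_card YX'.
  exists X', Y'; split=> //; first exact: subset_trans sY' (subsetDl _ _).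
  rewrite disjoint_sym disjoints_subset; apply: subset_trans sY' _.
  by rewrite setDE subsetIr.
have cU : #|X :|: Y| = #|X :\: Y| + #|Y|.
  by rewrite cardsU -(cardsID Y X); lia.
have cX := cardsID Y X.
have [le|lt] := leqP m #|X :\: Y|.
  have [X' sX' cX'] := subset_of_card le.
  exists X'; split=> //; first exact: subset_trans sX' (subsetDl _ _).
  suff -> : Y :\: X' = Y by [].
  apply/setDidPl; rewrite disjoint_sym disjoints_subset; apply: subset_trans sX' _.
  by rewrite setDE subsetIr.
have le : m - #|X :\: Y| <= #|X :&: Y| by lia.
have [Z sZ cZ] := subset_of_card le.
have sZY : Z \subset Y := subset_trans sZ (subsetIr _ _).
have dis : [disjoint X :\: Y & Z].
  rewrite disjoint_sym disjoints_subset; apply: subset_trans sZY _.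
  by rewrite setCD subsetUr.
exists ((X :\: Y) :|: Z); split.
- by rewrite subUset subsetDl (subset_trans sZ (subsetIl _ _)).
- by rewrite cardsU disjoint_setI0 // cards0; lia.
have -> : Y :\: (X :\: Y :|: Z) = Y :\: Z.
  by apply/setP => t; rewrite !inE; case: (t \in Y); rewrite ?andbF.
have := cardsID Z Y; rewrite (setIidPr sZY); lia.
Qed.

Lemma contains_double_star e x y X Y m k : symmetric e -> e x y ->
  {in X, forall z, e x z} -> {in Y, forall z, e y z} ->
  x \notin X :|: Y -> y \notin X :|: Y -> x != y ->
  [disjoint X & Y] -> #|X| = m -> #|Y| = k ->
  contains_subgraph (double_star m k) e.
Proof.
move=> esym exy eX eY xN yN xy dis cX cY.
(* The list follows the vertex numbering of [double_star]: backbone, leaves of [x], leaves of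
   [y]. *)
pose s := [:: x, y & enum X ++ enum Y].
have szX : size (enum X) = m by rewrite -cardE.
have szY : size (enum Y) = k by rewrite -cardE.
have us : uniq s.
  rewrite /= inE negb_or xy !mem_cat !mem_enum -!in_setU xN yN cat_uniq !enum_uniq /= !andbT.
  by apply/hasPn => z; rewrite !mem_enum => zY; rewrite (disjointFl dis).
have ss : size s = m + k + 2 by rewrite /= size_cat szX szY; lia.
exists (fun i : 'I_(m + k + 2) => nth x s i); split.
  move=> i j /eqP; rewrite nth_uniq ?ss ?ltn_ord // => /eqP; exact: val_inj.
suff H (i j : nat) : double_star_adj m k i j -> e (nth x s i) (nth x s j).
  by move=> i j /orP[/H //|/H]; rewrite esym.
case/or3P.
- by case/andP => /eqP-> /eqP->.
- case/andP => /eqP-> /andP[j2 jm]; case: j j2 jm => [|[|j]] // _ jm.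
  by rewrite /= nth_cat szX ifT; [apply: eX; rewrite -mem_enum mem_nth ?szX|]; lia.
case/andP => /eqP-> /andP[j2 jm]; case: j j2 jm => [|[|j]]; rewrite ?addn2 // => j2 jm.
rewrite /= nth_cat szX ifF; last by lia.
by apply: eY; rewrite -mem_enum mem_nth ?szY; lia.
Qed.

(** Without the backbone the neighbourhoods have sizes at least 3 and 4; if the inequality failed,
    their union would have at least 7 elements and the leaves could be chosen disjointly. *)
Lemma double_star_free_degrees e U x y : symmetric e -> irreflexive e ->
  ~ contains_subgraph (double_star 3 4) e -> x \in U -> y \in U -> e x y ->
  4 <= #|nb e U x| -> 5 <= #|nb e U y| ->
  #|nb e U x| + #|nb e U y| <= 8 + #|nb e (nb e U y) x|.
Proof.
move=> esym eirr free xU yU exy dx dy; rewrite leqNgt; apply/negP => big; apply: free.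
have xy : x != y by apply: contraTneq exy => ->; rewrite eirr.
pose X := nb e U x :\ y; pose Y := nb e U y :\ x.
have cX : #|nb e U x| = #|X|.+1 by rewrite (cardsD1 y) in_nb yU exy.
have cY : #|nb e U y| = #|Y|.+1 by rewrite (cardsD1 x) in_nb xU esym exy.
have cI : X :&: Y = nb e (nb e U y) x.
  apply/setP => z; rewrite !inE; case: (eqVneq z x) => [->|_]; rewrite ?eirr ?andbF //=.
  case: (eqVneq z y) => [->|_]; rewrite ?eirr ?andbF //=.
  by case: (z \in U); case: (e x z); case: (e y z).
have := cardsUI X Y; rewrite cI => cU.
have [|||X' [Y' [sX sY dis cX' cY']]] := @split_double_star X Y 3 4; try by lia.
apply: (contains_double_star esym exy _ _ _ _ xy dis cX' cY').
- by move=> z /(subsetP sX); rewrite !inE => /and3P[].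
- by move=> z /(subsetP sY); rewrite !inE => /and3P[].
- rewrite inE negb_or; apply/andP; split; apply/negP.
    by move/(subsetP sX); rewrite !inE eirr !andbF.
  by move/(subsetP sY); rewrite !inE eqxx.
rewrite inE negb_or; apply/andP; split; apply/negP.
  by move/(subsetP sX); rewrite !inE eqxx.
by move/(subsetP sY); rewrite !inE eirr !andbF.
Qed.

End DoubleStar.

(** * Removal of degree 7 and discharging *)

Section Discharging.
Variables (T : finType) (e : rel T).
Hypotheses (esym : symmetric e) (eirr : irreflexive e) (vke : vk_trivial e).
Hypothesis free : ~ contains_subgraph (double_star 3 4) e.
Implicit Types (U : {set T}).

Lemma ecount_bound1 U : 0 < #|U| -> ecount e U + 6 <= 6 * #|U|.
Proof.
move=> U0; have [U3|U3] := leqP 3 #|U|; first by have := ecount_bound esym eirr vke U3; lia.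
have := ecount_complete U eirr.
have : #|U| = 1 \/ #|U| = 2 by lia.
by case=> ->; lia.
Qed.

(* The neighbours of [y] of degree at least 4 have no neighbour outside [N[y]]. *)
Lemma degree7_reducible U y : y \in U -> #|nb e U y| = 7 ->
  exists2 S : {set T}, S \subset U &
    0 < #|S| /\ 7 * ecount e U <= 7 * ecount e (U :\: S) + 40 * #|S|.
Proof.
move=> yU dy; pose D := nb e U y.
pose L := [set x in D | #|nb e U x| <= 3].
pose M := y |: (D :\: L).
have sLD : L \subset D by apply/subsetP => x; rewrite inE => /andP[].
have sDU : D \subset U := nb_sub _ _ _.
have yD : y \notin D by rewrite in_nb eirr andbF.
have cM : #|M| + #|L| = 8.
  rewrite cardsU1 inE (negbTE yD) andbF add1n -dy -/D.
  by rewrite -(cardsID L D) (setIidPr sLD) addSn addnC.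
have sLU : L \subset U := subset_trans sLD sDU.
have sMU : M \subset U :\: L.
  apply/subsetP => x; rewrite in_setU1 !in_setD => /predU1P[->|/andP[-> /(subsetP sDU)->]] //.
  by rewrite yU andbT; apply: contra yD => /(subsetP sLD).
exists (M :|: L).
  by rewrite subUset sLU andbT; apply: subset_trans sMU (subsetDl _ _).
have dML : #|M :|: L| = 8.
  rewrite cardsU disjoint_setI0 ?cards0 ?subn0 //.
  by apply: disjointWl sMU _; rewrite disjoints_subset setDE subsetIr.
split; first by rewrite dML.
have E1 : ecount e U <= ecount e (U :\: L) + 6 * #|L|.
  rewrite (ecount_split esym sLU).
  have H : \sum_(x in L) #|nb e U x| <= 3 * #|L|.
    by rewrite mulnC -sum_nat_const; apply: leq_sum => x; rewrite inE => /andP[].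
  have : \sum_(x in L) #|nb e U x| = ecount e L + \sum_(x in L) #|nb e (U :\: L) x|.
    by rewrite -big_split; apply: eq_bigr => x _; rewrite (card_nb_split _ _ sLU).
  lia.
(* A neighbour [z] of [x] outside the closed neighbourhood of [y] would leave at most [d(x) - 2]
   common neighbours of [x] and [y], while at least [d(x) - 1] are forced. *)
have E2 : ecount e (U :\: L) = ecount e M + ecount e (U :\: (M :|: L)).
  rewrite (ecount_split esym sMU) setDDl setUC big1 ?muln0 ?addn0 // => x xM.
  apply/eqP; rewrite cards_eq0; apply/eqP/setP => z; rewrite in_nb in_set0.
  apply/negP => /andP[]; rewrite in_setD in_setU negb_or => /andP[/andP[zM zL] zU] exz.
  have {zM} : z \notin y |: D.
    by apply: contra zM; rewrite !in_setU1 in_setD zL.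
  rewrite !inE zU /= negb_or => /andP[zy eyz].
  move: xM; rewrite in_setU1 => /predU1P[xy|]; first by rewrite -xy exz in eyz.
  rewrite in_setD => /andP[xL xD]; move: xL; rewrite inE xD /= -ltnNge => dx.
  move: (xD); rewrite in_nb => /andP[xU eyx]; have exy : e x y by rewrite esym.
  have dy5 : 5 <= #|nb e U y| by rewrite dy.
  have := double_star_free_degrees esym eirr free xU yU exy dx dy5.
  rewrite dy -/D => H.
  have s : nb e D x \subset nb e U x :\ y :\ z.
    apply/subsetP => t; rewrite !inE => /andP[/andP[tU eyt] ext].
    rewrite tU ext !andbT; apply/andP; split.
      by apply: contraNneq eyz => <-.
    by apply: contraTneq eyt => ->; rewrite eirr.
  have := subset_leq_card s.
  have := cardsD1 y (nb e U x); have := cardsD1 z (nb e U x :\ y).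
  by rewrite !inE yU exy zU exz zy /=; move: H; clear; lia.
have M0 : 0 < #|M| by apply/card_gt0P; exists y; rewrite setU11.
(* The eight removed vertices cost at most [6 * 8 - 6 = 42], and [7 * 42 <= 40 * 8]. *)
have := ecount_bound1 M0; rewrite dML; move: E1 E2 cM; clear; lia.
Qed.

Section Weights.
Variable U : {set T}.
Hypothesis no7 : {in U, forall y, #|nb e U y| != 7}.
Let d x := #|nb e U x|.

(* Charges are in units of 1/7: a vertex [v] starts with [40 - 7 * d v], and
   [flow x y] is what [x] sends to its neighbour [y]. *)
Definition flow x y :=
  if 8 <= d y then 7 else
  if d y == 6 then (if d x <= 4 then 2 else if d x == 5 then 1 else 0) else 0.

Let high := [set x in U | 8 <= d x].
(** The overcharged vertices: they start with 19 and send 7 along each of three edges, ending at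
    -2. *)
Let low := [set x in U | (d x == 3) && (nb e U x \subset high)].

(** If [d x >= 4], the degree inequality would force at least [d x] common neighbours, but [y] is
    not one of them. *)
Lemma nb_high_low x y : x \in U -> y \in U -> e x y -> 8 <= d y -> d x <= 3.
Proof.
move=> xU yU exy dy; rewrite leqNgt; apply/negP => dx.
have dy5 : 5 <= #|nb e U y| by apply: leq_trans dy.
have := double_star_free_degrees esym eirr free xU yU exy dx dy5.
have yx : y \in nb e U x by rewrite in_nb yU.
have s : nb e (nb e U y) x \subset nb e U x :\ y.
  apply/subsetP => t; rewrite !inE => /andP[/andP[tU eyt] ext].
  by rewrite tU ext !andbT; apply: contraTneq eyt => ->; rewrite eirr.
have := subset_leq_card s; have := cardsD1 y (nb e U x); rewrite yx.
by move: dy; rewrite /d; clear; lia.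
Qed.

(** A vertex of degree 6 starts with -2. For each neighbour, twice its flow plus its codegree with
    [v] is at least 4, while the planar bound on the closed neighbourhood limits the sum of
    codegrees to 18; so the inflow is at least 3. *)
Lemma degree6_inflow v : v \in U -> d v = 6 -> 2 <= \sum_(x in nb e U v) flow x v.
Proof.
move=> vU dv; set N := nb e U v.
have vN : v \notin N by rewrite in_nb eirr andbF.
have cN : #|N| = 6 := dv.
have H : 4 * #|N| <= \sum_(x in N) (2 * flow x v + #|nb e N x|).
  rewrite mulnC -sum_nat_const; apply: leq_sum => x; rewrite in_nb => /andP[xU evx].
  have exv : e x v by rewrite esym.
  rewrite /flow dv /=; case: ifP => // dx4.
  have dx : 4 <= #|nb e U x| by rewrite -/(d x); lia.
  have dv5 : 5 <= #|nb e U v| by rewrite -/(d v) dv.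
  have := double_star_free_degrees esym eirr free xU vU exv dx dv5.
  rewrite -/(d x) -/(d v) dv -/N; case: ifP => dx5; move: dx4 dx5; clear; lia.
have cNv : #|v |: N| = 7 by rewrite cardsU1 vN cN.
have := @ecount_bound _ e (v |: N) esym eirr vke; rewrite cNv => /(_ isT).
rewrite (ecount_delete esym eirr (setU11 v N)) setU1K //.
have : #|N| <= #|nb e (v |: N) v|.
  by apply: subset_leq_card; apply/subsetP => x; rewrite !inE => /andP[-> ->]; rewrite orbT.
move: H; rewrite big_split /= -/(ecount e N) -big_distrr /= cN; clear; lia.
Qed.

(** A final charge is at least 40 on [high], at least -2 on [low], and nonnegative elsewhere. The
    tight case is degree 5, which starts with 5 and sends at most 1 to each neighbour. *)
Lemma flow_balance v : v \in U ->
  7 * d v + \sum_(x in nb e U v) flow v x + 40 * (v \in high) <=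
  40 + \sum_(x in nb e U v) flow x v + 2 * (v \in low).
Proof.
move=> vU; have out c : {in nb e U v, forall x, flow v x <= c} ->
    \sum_(x in nb e U v) flow v x <= d v * c.
  by move=> H; rewrite -sum_nat_const; apply: leq_sum.
have [d8|d8] := leqP 8 (d v).
  have -> : \sum_(x in nb e U v) flow v x = 0.
    apply: big1 => x; rewrite in_nb => /andP[xU evx].
    have dx : d x <= 3 by apply: (nb_high_low xU vU) => //; rewrite esym.
    rewrite /flow; case: ifP => [|_]; first by lia.
    by case: eqP => // E; rewrite E in dx.
  have -> : \sum_(x in nb e U v) flow x v = d v * 7.
    by rewrite -sum_nat_const; apply: eq_bigr => x _; rewrite /flow d8.
  by rewrite /high inE vU d8 /=; lia.
have vh : (v \in high) = false by rewrite inE vU /=; lia.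
rewrite vh muln0 addn0.
have [d3|d4] := leqP (d v) 3.
  have [vl|vl] := boolP (v \in low).
    have : \sum_(x in nb e U v) flow v x <= d v * 7.
      by apply: out => x _; rewrite /flow; do 2?case: ifP => //; case: ifP => // _; case: ifP.
    by rewrite /=; lia.
  have [d2|d2] := leqP (d v) 2.
    have : \sum_(x in nb e U v) flow v x <= d v * 7.
      by apply: out => x _; rewrite /flow; do 2?case: ifP => //; case: ifP => // _; case: ifP.
    by lia.
  move: vl; rewrite inE vU /=; have -> /= : d v == 3 by lia.
  (* The neighbour [x] outside [high] costs at most 2, so at most [2 + 14] of the initial 19 is
     sent. *)
  case/subsetPn => x xN xh; move: (xN); rewrite in_nb => /andP[xU evx].
  rewrite [X in _ + X](bigD1 x) //=.
  have : flow v x <= 2.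
    by rewrite inE xU /= in xh; rewrite /flow (negbTE xh); case: ifP => // _; case: ifP => // _; case: ifP.
  have : \sum_(i in nb e U v | i != x) flow v i <= 2 * 7.
    apply: (@leq_trans (\sum_(i in nb e U v :\ x) 7)).
      rewrite (eq_bigl (fun i => i \in nb e U v :\ x)) => [|i]; last by rewrite !inE andbC.
      by apply: leq_sum => i _; rewrite /flow; do 2?case: ifP => //; case: ifP => // _; case: ifP.
    rewrite sum_nat_const leq_mul2r /=; have := cardsD1 x (nb e U v).
    by rewrite xN -/(d v); lia.
  by lia.
have nh x : x \in nb e U v -> (8 <= d x) = false.
  rewrite in_nb => /andP[xU evx]; apply/negP => dx.
  by have := nb_high_low vU xU evx dx; lia.
have [d5|d6] := leqP (d v) 5.
  have [d45|d45] : d v = 4 \/ d v = 5 by lia.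
    have : \sum_(x in nb e U v) flow v x <= d v * 2.
      by apply: out => x xN; rewrite /flow nh // d45; case: ifP.
    by lia.
  have : \sum_(x in nb e U v) flow v x <= d v * 1.
    by apply: out => x xN; rewrite /flow nh // d45; case: ifP.
  by lia.
have := no7 vU; rewrite -/(d v) => n7.
have dv : d v = 6 by lia.
have : \sum_(x in nb e U v) flow v x <= d v * 0.
  by apply: out => x xN; rewrite /flow nh // dv; case: ifP.
have := degree6_inflow vU dv; lia.
Qed.

Lemma card_low : #|low| <= 19 * #|high|.
Proof.
have := @three_nbs_bound _ e high low esym eirr vke.
suff [H1 H2] : [disjoint high & low] /\ {in low, forall b, 3 <= #|nb e high b|}.
  by move=> /(_ H1 H2); lia.
split.
  rewrite -setI_eq0; apply/eqP/setP => x; rewrite !inE.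
  by apply/negP => /andP[/andP[_ dx] /and3P[_ /eqP dx3 _]]; rewrite dx3 in dx.
move=> b; rewrite inE => /and3P[bU /eqP <- sh]; apply: subset_leq_card.
apply/subsetP => x xN; rewrite in_nb (subsetP sh) //=.
by move: xN; rewrite in_nb => /andP[].
Qed.

(** Summed over [U] the flows cancel, and the deficit [2 * #|low| <= 38 * #|high|] is covered by the
    surplus [40 * #|high|]. *)
Lemma ecount_no7 : 7 * ecount e U <= 40 * #|U|.
Proof.
have H : \sum_(v in U) (7 * d v + \sum_(x in nb e U v) flow v x + 40 * (v \in high)) <=
  \sum_(v in U) (40 + \sum_(x in nb e U v) flow x v + 2 * (v \in low)).
  by apply: leq_sum => v; apply: flow_balance.
have sum_ind (X : {set T}) : X \subset U -> \sum_(v in U) (v \in X : nat) = #|X|.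
  move=> /setIidPr sXU; rewrite -sum1_card -[in RHS]sXU [LHS]big_mkcond [RHS]big_mkcond.
  by apply: eq_bigr => v _; rewrite inE; case: (v \in U); case: (v \in X).
have exch : \sum_(v in U) \sum_(x in nb e U v) flow v x = \sum_(v in U) \sum_(x in nb e U v) flow x v.
  under eq_bigr => v _ do (under eq_bigl => x do rewrite in_nb; rewrite big_mkcondr /=).
  under [RHS]eq_bigr => v _ do (under eq_bigl => x do rewrite in_nb; rewrite big_mkcondr /=).
  by rewrite exchange_big /=; apply: eq_bigr => v _; apply: eq_bigr => x _; rewrite esym.
have sum3 (f g h : T -> nat) : \sum_(v in U) (f v + g v + h v) =
    \sum_(v in U) f v + \sum_(v in U) g v + \sum_(v in U) h v by rewrite !big_split.
move: H; rewrite !sum3 -!big_distrr /= exch sum_nat_const.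
rewrite -/(ecount e U) !sum_ind; first by have := card_low; lia.
  by apply/subsetP => x; rewrite inE => /andP[].
by apply/subsetP => x; rewrite inE => /andP[].
Qed.

End Weights.

Lemma ecount_double_star_free U : 7 * ecount e U <= 40 * #|U|.
Proof.
have [m] := ubnP #|U|; elim: m U => // m IH U lt_m.
have [/exists_inP[y yU /eqP dy]|/exists_inPn no7] := boolP [exists y in U, #|nb e U y| == 7].
  have [S sSU [S0 HS]] := degree7_reducible yU dy.
  have cS := cardsID S U; rewrite (setIidPr sSU) in cS.
  have : 7 * ecount e (U :\: S) <= 40 * #|U :\: S| by apply: IH; lia.
  lia.
exact: ecount_no7.
Qed.

End Discharging.

(** * From oriented counts to the number of edges *)

Lemma num_edges_ecount (T : finType) (e : rel T) : symmetric e -> irreflexive e ->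
  2 * num_edges e <= ecount e [set: T].
Proof.
move=> esym eirr; rewrite /num_edges mulnC -sum_nat_const.
have -> : \sum_(E in edge_set e) 2 = \sum_(E in edge_set e) \sum_(x in [set: T]) (x \in E).
  apply: eq_bigr => E; rewrite inE => /existsP[x /existsP[y /andP[exy /eqP ->]]].
  have xy : x != y by apply: contraTneq exy => ->; rewrite eirr.
  have <- : #|[set x; y]| = 2 by rewrite cards2 xy.
  rewrite -sum1_card big_mkcond [RHS]big_mkcond; apply: eq_bigr => z _.
  by rewrite in_setT; case: (z \in _).
rewrite exchange_big; apply: leq_sum => x _.
have -> : \sum_(E in edge_set e) (x \in E) = #|[set E in edge_set e | x \in E]|.
  rewrite -sum1_card big_mkcond [RHS]big_mkcond; apply: eq_bigr => E _.
  by rewrite [in RHS]in_set; case: (E \in edge_set e); case: (x \in E).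
apply: (@leq_trans #|[set [set x; y] | y in nb e [set: T] x]|); last exact: leq_imset_card.
apply: subset_leq_card; apply/subsetP => E /setIdP[].
rewrite inE => /existsP[a /existsP[b /andP[eab /eqP ->]]] /set2P[]->.
  by apply/imsetP; exists b; rewrite // in_nb in_setT.
by apply/imsetP; exists a; rewrite 1?setUC // in_nb in_setT esym.
Qed.

(* ex_P(n, S_{3,4}) <= 20n/7: every n-vertex planar simple graph with no
   subgraph isomorphic to S_{3,4} has at most 20n/7 edges (i.e. 7|E| <= 20n). *)
Theorem theorem1p1 :
  forall (n : nat), 1 <= n ->
  forall (T : finType) (e : rel T),
    #|T| = n -> simple_graph e -> planar e ->
    ~ contains_subgraph (double_star 3 4) e ->
    7 * num_edges e <= 20 * n.
Proof.
move=> n _ T e cT [esym eirr'] pl free.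
have eirr : irreflexive e by move=> x; apply/negbTE.
have := num_edges_ecount esym eirr.
have := ecount_double_star_free esym eirr (planar_vk_trivial pl) free [set: T].
rewrite cardsT cT; lia.
Qed.
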